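(* The $2$-form $$\Omega=\sum_{i,j\in I}\widetilde\varepsilon_{ij}\,d\log A_i\wedge d\log A_j,\qquad\widetilde\varepsilon_{ij}=d_i\varepsilon_{ij},$$ does not depend on the choice of cluster coordinates $\{A_i\}$; that is, the forms defined by this formula on the seed $\mathcal A$-tori of all seeds equivalent to a given one are identified by the cluster transformations.
   Context: A seed $\mathbf i=(I,I_0,\varepsilon,d)$ consists of a finite set $I$, a subset $I_0\subset I$ of frozen elements, a $\mathbb Q$-valued function $\varepsilon=(\varepsilon_{ij})$ on $I\times I$ with $\varepsilon_{ij}\in\mathbb Z$ unless $i,j$ are both in $I_0$, and positive integers $\{d_i\}_{i\in I}$ with greatest common divisor $1$ such that $\varepsilon_{ij}d_j^{-1}$ is skew-symmetric. For $k\in I\setminus I_0$ the mutated seed $\mu_k(\mathbf i)=(I,I_0,\varepsilon',d)$ is given by $\varepsilon'_{ij}=-\varepsilon_{ij}$ if $k\in\{i,j\}$; $\varepsilon'_{ij}=\varepsilon_{ij}$ if $k\notin\{i,j\}$ and $\varepsilon_{ik}\varepsilon_{kj}\le 0$; $\varepsilon'_{ij}=\varepsilon_{ij}+|\varepsilon_{ik}|\varepsilon_{kj}$ if $k\notin\{i,j\}$ and $\varepsilon_{ik}\varepsilon_{kj}>0$. The seed torus $\mathcal A_{\mathbf i}$ is the split torus with coordinates $\{A_i\}_{i\in I}$; mutations induce birational maps $\mathcal A_{\mathbf i}\to\mathcal A_{\mu_k(\mathbf i)}$, $$A_k\,\mu_k^*A'_k=\prod_{\varepsilon_{kj}>0}A_j^{\varepsilon_{kj}}+\prod_{\varepsilon_{kj}<0}A_j^{-\varepsilon_{kj}},\qquad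 \mu_k^*A'_i=A_i\ (i\neq k)$$ (empty products are $1$), and seed isomorphisms (bijections of index sets preserving frozen elements, $\varepsilon$, $d$) act by relabelling. Cluster transformations are compositions of these; seeds so related are equivalent. *)

(* Defs.v *)
From HB Require Import structures.
From mathcomp Require Import all_boot all_order all_algebra fraction.
From mathcomp Require Import mpoly.

Set Implicit Arguments.
Unset Strict Implicit.
Unset Printing Implicit Defensive.

Import Order.TTheory GRing.Theory Num.Theory.
Local Open Scope ring_scope.

Record seed := Seed {
  idx : finType;
  frozen : {set idx};
  eps : idx -> idx -> rat;
  sd : idx -> nat;
  seed_int : forall i j,
    ~~ ((i \in frozen) && (j \in frozen)) -> eps i j \is a Num.int;
  seed_gt0 : forall i, (0 < sd i)%N;
  seed_gcd : \big[gcdn/0%N]_(i : idx) sd i = 1%N;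
  seed_skew : forall i j,
    eps i j / (sd j)%:R = - (eps j i / (sd i)%:R)
}.

Section SeedMutation.
Variables (s : seed) (k : idx s).

Definition mut_eps (i j : idx s) : rat :=
  if (k == i) || (k == j) then - eps i j
  else if eps i k * eps k j <= 0 then eps i j
  else eps i j + `|eps i k| * eps k j.

Hypothesis k_mutable : k \notin frozen s.

Lemma mut_int (i j : idx s) :
  ~~ ((i \in frozen s) && (j \in frozen s)) -> mut_eps i j \is a Num.int.
Proof.
move=> /seed_int eij; rewrite /mut_eps; case: ifP => _; first by rewrite rpredN.
have ik : eps i k \is a Num.int by rewrite seed_int // (negbTE k_mutable) andbF.
have kj : eps k j \is a Num.int by rewrite seed_int // (negbTE k_mutable).
by case: ifP => // _; apply: rpredD eij (rpredM (intr_nat (natr_norm_int ik)) kj).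
Qed.

Lemma mut_skew (i j : idx s) :
  mut_eps i j / (sd j)%:R = - (mut_eps j i / (sd i)%:R).
Proof.
have p (l : idx s) : 0 < (sd l)%:R :> rat by rewrite ltr0n seed_gt0.
pose h (a b : idx s) : rat := eps a b / (sd b)%:R.
have epsE a b : eps a b = h a b * (sd b)%:R by rewrite divfK ?gt_eqF.
have hN a b : h a b = - h b a by rewrite /h seed_skew.
clearbody h.
have uvE : (eps i k * eps k j <= 0) = (h i k * h k j <= 0).
  by rewrite !epsE mulrACA pmulr_lle0 ?mulr_gt0.
have vuE : (eps j k * eps k i <= 0) = (h i k * h k j <= 0).
  rewrite !epsE mulrACA pmulr_lle0 ?mulr_gt0 //.
  by rewrite (hN j k) (hN k i) mulrNN mulrC.
rewrite /mut_eps orbC uvE vuE; case: ifP => _.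
  by rewrite !mulNr seed_skew.
case: ifP => [_|/negbT]; first by rewrite seed_skew.
rewrite -ltNge => uv0.
rewrite !mulrDl seed_skew opprD; congr (_ + _).
rewrite !epsE (hN j k) (hN k i) !mulrA !mulfK ?gt_eqF //.
rewrite !normrM !normrN !(gtr0_norm (p _)) mulrN opprK.
rewrite mulrAC [RHS]mulrAC; congr (_ * _).
case: (ltrgt0P (h i k)) uv0 => [u0|u0|->]; last by rewrite mul0r ltxx.
  by rewrite pmulr_rgt0 // => v0; rewrite (gtr0_norm v0) mulrC.
by rewrite nmulr_rgt0 // => v0; rewrite (ltr0_norm v0) !mulNr mulrC.
Qed.

Definition mutate : seed := Seed mut_int (@seed_gt0 s) (@seed_gcd s) mut_skew.

End SeedMutation.

Section RationalForms.
Variable F : fieldType.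

(* The field of rational functions on the split torus over F with coordinates
   indexed by I; the coordinate of i is the variable numbered [enum_rank i]. *)
Definition ratfun (I : finType) : fieldType := {fraction {mpoly F[#|I|]}}.

Definition Acoord (I : finType) (i : I) : ratfun I :=
  tofrac ('X_(enum_rank i) : {mpoly F[#|I|]}).

(* A rational map from the I-torus to the J-torus, given by the pullbacks of
   the coordinates of the target. *)
Definition ratmap (I J : finType) := J -> ratfun I.

Definition poly_pullback (I J : finType) (f : ratmap I J)
    (p : {mpoly F[#|J|]}) : ratfun I :=
  mmap (fun c : F => tofrac (c%:MP : {mpoly F[#|I|]}))
       (fun a => f (enum_val a)) p.

(* Substitution in a fraction p/q.  It does not depend on the fraction chosen
   when f is dominant, in which case no nonzero q pulls back to 0. *)
Definition pullback (I J : finType) (f : ratmap I J) (g : ratfun J) :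
    ratfun I :=
  poly_pullback f \n_(repr g) / poly_pullback f \d_(repr g).

Definition ratmap_comp (I J L : finType) (h : ratmap J L) (f : ratmap I J) :
    ratmap I L :=
  fun l => pullback f (h l).

(* Partial derivative, by the quotient rule. *)
Definition pderiv (I : finType) (a : 'I_#|I|) (g : ratfun I) : ratfun I :=
  let p := \n_(repr g) in let q := \d_(repr g) in
  tofrac (p^`M(a) * q - p * q^`M(a)) / tofrac (q ^+ 2).

(* Rational 1-forms, in the basis of the differentials of the coordinates. *)
Definition form1 (I : finType) := 'rV[ratfun I]_#|I|.

(* A rational 2-form is represented by the alternating matrix of its values on
   pairs of coordinate vector fields. *)
Definition form2 (I : finType) := 'M[ratfun I]_#|I|.

Definition differential (I : finType) (g : ratfun I) : form1 I :=
  \row_a pderiv a g.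

Definition dlog (I : finType) (g : ratfun I) : form1 I :=
  g^-1 *: differential g.

Definition wedge (I : finType) (u v : form1 I) : form2 I :=
  u^T *m v - v^T *m u.

Definition jacobian (I J : finType) (f : ratmap I J) :
    'M[ratfun I]_(#|J|, #|I|) :=
  \matrix_(a, b) pderiv b (f (enum_val a)).

Definition pullback2 (I J : finType) (f : ratmap I J) (w : form2 J) :
    form2 I :=
  (jacobian f)^T *m map_mx (pullback f) w *m jacobian f.

Definition Omega (s : seed) : form2 (idx s) :=
  \sum_(i : idx s) \sum_(j : idx s)
    ratr ((sd i)%:R * eps i j) *: wedge (dlog (Acoord i)) (dlog (Acoord j)).

(* For k mutable, [eps k j] is an integer, equal to its floor. *)
Definition mutation_map (s : seed) (k : idx s) : ratmap (idx s) (idx s) :=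
  fun i =>
    if i == k then
      (\prod_(j | 0 < eps k j) Acoord j ^ Num.floor (eps k j)
       + \prod_(j | eps k j < 0) Acoord j ^ (- Num.floor (eps k j)))
      / Acoord k
    else Acoord i.

Record seed_iso (s t : seed) := SeedIso {
  iso_fun : idx s -> idx t;
  iso_inv : idx t -> idx s;
  iso_funK : cancel iso_fun iso_inv;
  iso_invK : cancel iso_inv iso_fun;
  iso_frozen : forall i, (iso_fun i \in frozen t) = (i \in frozen s);
  iso_eps : forall i j, eps (iso_fun i) (iso_fun j) = eps i j;
  iso_sd : forall i, sd (iso_fun i) = sd i
}.

(* The coordinate of [iso_fun i] pulls back to the coordinate of i. *)
Definition iso_map (s t : seed) (u : seed_iso s t) : ratmap (idx s) (idx t) :=
  fun i => Acoord (iso_inv u i).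

(* Inverses need no constructor: mutating twice in the same direction gives
   the original seed up to the isomorphism with identity underlying map. *)
Inductive cluster_transformation :
    forall s t : seed, ratmap (idx s) (idx t) -> Prop :=
| cluster_mutation (s : seed) (k : idx s) (hk : k \notin frozen s) :
    @cluster_transformation s (mutate hk) (mutation_map k)
| cluster_iso (s t : seed) (u : seed_iso s t) :
    @cluster_transformation s t (iso_map u)
| cluster_comp (s t r : seed) (f : ratmap (idx s) (idx t))
    (g : ratmap (idx t) (idx r)) :
    cluster_transformation f -> cluster_transformation g ->
    @cluster_transformation s r (ratmap_comp g f).

End RationalForms.

(* Main.v *)
From HB Require Import structures.
Require Import Defs.
From mathcomp Require Import all_boot all_order all_algebra fraction.
From mathcomp Require Import generic_quotient ring mpoly.

(** Both kinds of elementary map are handled by a direct computation with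
    logarithmic differentials, and composites by functoriality of pullback.

    Functoriality is where substitution needs care: [pullback f] evaluates f on
    the numerator and the denominator of a chosen representative, so it is a
    ring morphism only when f is dominant, i.e. when no nonzero polynomial
    pulls back to 0.  The induction over a cluster transformation therefore
    proves dominance together with the invariance of the form.  Dominance comes
    from the Jacobian criterion [dominant_jacobian]: in characteristic 0, if the
    Jacobian matrix has independent rows, then a nonzero polynomial of minimal
    degree killed by substitution would, by the chain rule, have all its partial
    derivatives killed as well, hence zero, so it would be constant.  For a
    dominant f the chain rule extends to fractions ([chain_rule]), the Jacobian
    of a composite is the expected product, and pullback of 2-forms is
    functorial ([pullback2_comp]) and sends dlog g /\ dlog h to
    dlog (f^* g) /\ dlog (f^* h) ([pullback2_wedge_dlog]).

    A seed isomorphism reindexes the double sum.  For a mutation at k, write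
    a_j = dlog A_j, let x_j and y_j be the positive and negative parts of
    eps_kj, put m = sum_j x_j a_j and n = sum_j y_j a_j, and let M and N be the
    two monomials of the exchange relation, so that dlog M = m and dlog N = n.
    The pullback of dlog A'_k is theta - a_k with
    theta = dlog (M + N) = (M m + N n) / (M + N), and therefore
<<
      theta /\ (m - n) = - m /\ n,
>>
    an expression in which M and N no longer appear.  On the other side the
    mutation rule changes the coefficients d_i eps_ij, for i and j different
    from k, by d_k (y_i x_j - x_i y_j), which contributes
    d_k (n /\ m - m /\ n) = - 2 d_k m /\ n, while the coefficients with i = k or
    j = k change sign, so that the corresponding terms exceed their old value
    2 d_k a_k /\ (m - n) by - 2 d_k theta /\ (m - n) = 2 d_k m /\ n.
    The two corrections cancel; this is [mutation_identity], valid for any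
    alternating bilinear map. *)

Set Implicit Arguments.
Unset Strict Implicit.
Unset Printing Implicit Defensive.

Import Order.TTheory GRing.Theory Num.Theory.
Local Open Scope ring_scope.

(** * Fractions and rational scalars *)

Lemma frac_numden (R : idomainType) (g : {fraction R}) :
  g = FracField.tofrac \n_(repr g) / FracField.tofrac \d_(repr g).
Proof.
rewrite -{1}[g]reprK; set x := repr g.
unlock FracField.tofrac.
rewrite -[X in _ = _ * X]FracField.pi_inv -[RHS]FracField.pi_mul.
apply: congr1; rewrite /FracField.invf /FracField.mulf.
rewrite !numden_Ratio ?oner_eq0 ?denom_ratioP //.
by rewrite mul1r mulr1 Ratio_numden.
Qed.

Lemma quotient_rule_add (K : fieldType) (p q r s p' q' r' s' : K) :
  q != 0 -> s != 0 ->
  ((p' * s + p * s' + (r' * q + r * q')) * (q * s)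
    - (p * s + r * q) * (q' * s + q * s')) / (q * s) ^+ 2
  = (p' * q - p * q') / q ^+ 2 + (r' * s - r * s') / s ^+ 2.
Proof. by move=> q0 s0; field; rewrite q0 s0. Qed.

Lemma quotient_rule_mul (K : fieldType) (p q r s p' q' r' s' : K) :
  q != 0 -> s != 0 ->
  ((p' * r + p * r') * (q * s) - (p * r) * (q' * s + q * s')) / (q * s) ^+ 2
  = (p' * q - p * q') / q ^+ 2 * (r / s) + p / q * ((r' * s - r * s') / s ^+ 2).
Proof. by move=> q0 s0; field; rewrite q0 s0. Qed.

Section RatrPchar0.
Variable K : fieldType.
Hypothesis charK : [pchar K] =i pred0.

Lemma intr_eq0_pchar0 (z : int) : (z%:~R == 0 :> K) = (z == 0).
Proof.
case: z => n; first exact: (proj1 (pcharf0P K) charK).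
by rewrite NegzE mulrNz !oppr_eq0 (proj1 (pcharf0P K) charK).
Qed.

Lemma ratr_div (a b : int) : b != 0 ->
  ratr (a%:~R / b%:~R) = a%:~R / b%:~R :> K.
Proof.
move=> b0; set r : rat := a%:~R / b%:~R; rewrite /ratr.
have E : numq r * b = a * denq r.
  apply: (@intr_inj rat).
  by rewrite !rmorphM /= numqE /r mulrAC divfK // intr_eq0.
apply/eqP; rewrite eqr_div ?intr_eq0_pchar0 ?denq_neq0 //.
by rewrite -!rmorphM E.
Qed.

Lemma ratr_zmod_morphism : zmod_morphism (@ratr K).
Proof.
move=> x y.
have -> : x - y = (numq x * denq y - numq y * denq x)%:~R
                  / (denq x * denq y)%:~R.
  rewrite rmorphB !rmorphM /= !numqE; field.
  by rewrite !intr_eq0 !denq_neq0.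
rewrite ratr_div ?mulf_neq0 ?denq_neq0 // rmorphB !rmorphM /=.
by rewrite /ratr -[in RHS]mulNr addf_div ?intr_eq0_pchar0 ?denq_neq0 // mulNr.
Qed.

Lemma ratr_monoid_morphism : monoid_morphism (@ratr K).
Proof.
split=> [|x y]; first by rewrite /ratr divr1.
have -> : x * y = (numq x * numq y)%:~R / (denq x * denq y)%:~R.
  by rewrite !rmorphM /= -mulf_div !divq_num_den.
by rewrite ratr_div ?mulf_neq0 ?denq_neq0 // !rmorphM /= -mulf_div.
Qed.

(** Characteristic 0 keeps the denominators of rational numbers invertible,
    which makes the embedding of the rationals a ring morphism even when the
    field carries no order. *)
Definition ratr_rmorphism : {rmorphism rat -> K} :=
  HB.pack (@ratr K)
    (GRing.isZmodMorphism.Build rat K (@ratr K) ratr_zmod_morphism)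
    (GRing.isMonoidMorphism.Build rat K (@ratr K) ratr_monoid_morphism).

End RatrPchar0.

(** * Logarithmic derivatives *)

Section LogarithmicDerivative.
Variables (K : fieldType) (V : lmodType K) (D : K -> V).
Hypothesis D_add : forall g h, D (g + h) = D g + D h.
Hypothesis D_mul : forall g h, D (g * h) = h *: D g + g *: D h.

Definition logder g := g^-1 *: D g.

Lemma logderK g : g != 0 -> D g = g *: logder g.
Proof. by move=> g0; rewrite /logder scalerA mulfV // scale1r. Qed.

Lemma logderM g h : g != 0 -> h != 0 -> logder (g * h) = logder g + logder h.
Proof.
move=> g0 h0; rewrite /logder D_mul scalerDr !scalerA invfM.
by rewrite mulfVK // mulrAC mulVf // mul1r.
Qed.

Lemma logder1 : logder 1 = 0.
Proof.
have := @logderM 1 1 (oner_neq0 _) (oner_neq0 _); rewrite mulr1 => /eqP.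
by rewrite -subr_eq0 opprD addNKr oppr_eq0 => /eqP.
Qed.

Lemma logderV g : g != 0 -> logder g^-1 = - logder g.
Proof.
move=> g0; apply/eqP; rewrite -addr_eq0 -logderM ?invr_eq0 //.
by rewrite mulVf // logder1.
Qed.

Lemma logderXz g (z : int) : g != 0 -> logder (g ^ z) = z%:~R *: logder g.
Proof.
move=> g0; have logderX n : logder (g ^+ n) = n%:R *: logder g.
  elim: n => [|n IHn]; first by rewrite expr0 logder1 scale0r.
  by rewrite exprS logderM ?expf_neq0 // IHn mulrS scalerDl scale1r.
case: z => n; first exact: logderX.
rewrite -[g ^ _]/(g ^- n.+1) logderV ?expf_neq0 // logderX.
by rewrite NegzE mulrNz scaleNr.
Qed.

Lemma logder_prod (T : finType) (P : pred T) (G : T -> K) :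
  (forall j, P j -> G j != 0) ->
  logder (\prod_(j | P j) G j) = \sum_(j | P j) logder (G j).
Proof.
move=> G0.
(* Logarithmic derivatives add up only over nonzero factors, so the induction
   carries nonvanishing of the partial products. *)
pose Q x (u : V) := x != 0 /\ logder x = u.
suff [] : Q (\prod_(j | P j) G j) (\sum_(j | P j) logder (G j)) by [].
apply: (big_ind2 Q) => [|x u y v [x0 <-] [y0 <-]|j Pj].
- by rewrite /Q oner_neq0 logder1.
- by rewrite /Q mulf_neq0 // logderM.
- by split=> //; exact: G0.
Qed.

Lemma logderD g h : g != 0 -> h != 0 ->
  logder (g + h) = (g + h)^-1 *: (g *: logder g + h *: logder h).
Proof. by move=> g0 h0; rewrite {1}/logder D_add !logderK. Qed.

End LogarithmicDerivative.

(** * Alternating forms and the mutation identity *)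

Section AlternatingForm.
Variables (K : fieldType) (V W : lmodType K) (B : V -> V -> W).
Hypothesis B_addl : forall u v w, B (u + v) w = B u w + B v w.
Hypothesis B_scalel : forall c u w, B (c *: u) w = c *: B u w.
Hypothesis B_skew : forall u v, B u v = - B v u.
Hypothesis B_alt : forall u, B u u = 0.

Lemma form_addr u v w : B w (u + v) = B w u + B w v.
Proof. by rewrite B_skew B_addl opprD -!B_skew. Qed.

Lemma form_scaler c u w : B w (c *: u) = c *: B w u.
Proof. by rewrite B_skew B_scalel -scalerN -B_skew. Qed.

Lemma form_suml (T : finType) (U : T -> V) w :
  B (\sum_j U j) w = \sum_j B (U j) w.
Proof.
apply: (big_morph (fun u => B u w)) => [u v|]; first exact: B_addl.
by rewrite -(scale0r w) B_scalel !scale0r.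
Qed.

Lemma form_sumr (T : finType) (U : T -> V) w :
  B w (\sum_j U j) = \sum_j B w (U j).
Proof.
by rewrite B_skew form_suml -sumrN; apply: eq_bigr => j _; rewrite -B_skew.
Qed.

Variables (T : finType) (a : T -> V).

Lemma form_lincomb (x y : T -> K) :
  B (\sum_i x i *: a i) (\sum_j y j *: a j)
  = \sum_i \sum_j (x i * y j) *: B (a i) (a j).
Proof.
rewrite form_suml; apply: eq_bigr => i _; rewrite B_scalel form_sumr scaler_sumr.
by apply: eq_bigr => j _; rewrite form_scaler scalerA.
Qed.

Variables (k : T) (c : T -> T -> K) (x y : T -> K) (D M N : K).
Hypothesis c_skew : forall i j, c i j = - c j i.
Hypothesis c_k : forall j, c k j = D * (x j - y j).
Hypothesis x_k : x k = 0.
Hypothesis y_k : y k = 0.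
Hypothesis MN : M + N != 0.

Let m := \sum_j x j *: a j.
Let n := \sum_j y j *: a j.
Let theta := (M + N)^-1 *: (M *: m + N *: n).
Let w := theta - 2%:R *: a k.

(** The mutation rule for the coefficients d_i eps_ij, in one formula: c is the
    old coefficient, x and y are the positive and negative parts of row k of
    eps, and D is d_k.  As x and y vanish at k, the quadratic term only matters
    off row and column k, and the last two terms change the sign of that row
    and column. *)
Definition mutated_coef i j :=
  c i j + D * (y i * x j - x i * y j)
  - (i == k)%:R * (2%:R * c i j) - (j == k)%:R * (2%:R * c i j).

Let sum_row (d : T -> T -> K) (X : T -> T -> W) :
  \sum_i \sum_j ((i == k)%:R * d i j) *: X i j = \sum_j d k j *: X k j.
Proof.
rewrite (bigD1 k) //= [X in _ + X]big1 ?addr0 => [|i /negbTE->].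
  by apply: eq_bigr => j _; rewrite eqxx mul1r.
by rewrite big1 // => j _; rewrite mul0r scale0r.
Qed.

Let sum_col (d : T -> T -> K) (X : T -> T -> W) :
  \sum_i \sum_j ((j == k)%:R * d i j) *: X i j = \sum_i d i k *: X i k.
Proof.
by rewrite exchange_big (sum_row (fun j i => d i j) (fun j i => X i j)).
Qed.

(** The (k, k) term contributes nothing beyond the two linear corrections,
    because the form is alternating. *)
Let sum_perturb (d : T -> T -> K) (v : V) :
  \sum_i \sum_j d i j *: B (a i + (i == k)%:R *: v) (a j + (j == k)%:R *: v)
  = \sum_i \sum_j d i j *: B (a i) (a j)
    + (\sum_i d i k *: B (a i) v + \sum_j d k j *: B v (a j)).
Proof.
rewrite -(sum_row d (fun _ j => B v (a j))).
rewrite -(sum_col d (fun i _ => B (a i) v)) -!big_split /=.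
apply: eq_bigr => i _; rewrite -!big_split /=; apply: eq_bigr => j _.
rewrite !B_addl !form_addr !B_scalel !form_scaler B_alt !scaler0 addr0.
rewrite -!addrA !scalerDr !scalerA; congr (_ + _).
by congr (_ *: _ + _ *: _); rewrite mulrC.
Qed.

Let c_row u : \sum_j c k j *: B u (a j) = D *: B u (m - n).
Proof.
rewrite -sumrB form_sumr scaler_sumr; apply: eq_bigr => j _.
by rewrite c_k -scalerBl form_scaler scalerA.
Qed.

Let c_col u : \sum_i c i k *: B (a i) u = D *: B u (m - n).
Proof.
rewrite -c_row; apply: eq_bigr => i _.
by rewrite c_skew B_skew scalerN scaleNr opprK.
Qed.

(** The monomials M and N cancel because
    (M m + N n) /\ (m - n) = - (M + N) m /\ n. *)
Let B_theta : B theta (m - n) = - B m n.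
Proof.
have BN p q : B p (- q) = - B p q by rewrite -scaleN1r form_scaler scaleN1r.
rewrite B_scalel B_addl !B_scalel !form_addr !BN !B_alt oppr0 add0r addr0.
by rewrite (B_skew n m) -scalerDl scalerA mulVf // scale1r.
Qed.

(** Writing b_i = a_i + [i = k] w with w = theta - 2 a_k, the left-hand side is
    the sum of its value at the a_i, of which the excess over the right-hand
    side is - 2 D m /\ n - 4 D a_k /\ (m - n), and of - 2 D w /\ (m - n), which
    is the opposite of that excess. *)
Lemma mutation_identity (b : T -> V) :
  (forall i, i != k -> b i = a i) -> b k = theta - a k ->
  \sum_i \sum_j mutated_coef i j *: B (b i) (b j)
  = \sum_i \sum_j c i j *: B (a i) (a j).
Proof.
move=> b_ne b_k; set S := RHS.
have bE i : b i = a i + (i == k)%:R *: w.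
  have [->|ik] := eqVneq i k; last by rewrite scale0r addr0 b_ne.
  rewrite scale1r b_k /w addrCA; congr (_ + _).
  by rewrite scaler_nat mulr2n opprD addNKr.
have ckk : c k k = 0 by rewrite c_k x_k y_k subrr mulr0.
pose C := mutated_coef.
(* Row and column k of the mutated coefficients are the opposites of the old
   ones, so the two linear corrections are equal. *)
have Ckj j : C k j = - c k j.
  rewrite /C /mutated_coef eqxx x_k y_k.
  by case: eqVneq => [->|_] /=; rewrite ?x_k ?y_k ?ckk; ring.
have Cik i : C i k = - c i k.
  rewrite /C /mutated_coef eqxx x_k y_k.
  by case: eqVneq => [->|_] /=; rewrite ?x_k ?y_k ?ckk; ring.
under eq_bigr do under eq_bigr do rewrite !bE.
rewrite -/C sum_perturb.
have -> : \sum_i C i k *: B (a i) w = - (D *: B w (m - n)).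
  by rewrite -c_col -sumrN; apply: eq_bigr => i _; rewrite Cik scaleNr.
have -> : \sum_j C k j *: B w (a j) = - (D *: B w (m - n)).
  by rewrite -c_row -sumrN; apply: eq_bigr => j _; rewrite Ckj scaleNr.
have -> : \sum_i \sum_j C i j *: B (a i) (a j)
    = S + D *: (B n m - B m n)
      - 2%:R *: (D *: B (a k) (m - n)) - 2%:R *: (D *: B (a k) (m - n)).
  rewrite -{1}c_row -c_col !scaler_sumr.
  under [X in _ - X - _]eq_bigr do rewrite scalerA.
  under [X in _ - X]eq_bigr do rewrite scalerA.
  rewrite -(sum_row (fun i j => 2%:R * c i j) (fun i j => B (a i) (a j))).
  rewrite -(sum_col (fun i j => 2%:R * c i j) (fun i j => B (a i) (a j))).
  rewrite !form_lincomb -sumrB scaler_sumr -big_split -!sumrB /=.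
  apply: eq_bigr => i _; rewrite -sumrB scaler_sumr -big_split -!sumrB /=.
  by apply: eq_bigr => j _; rewrite -scalerBl scalerA -scalerDl -!scalerBl.
have -> : B w (m - n) = - B m n - 2%:R *: B (a k) (m - n).
  by rewrite B_addl B_theta -(scaleNr 2%:R (a k)) B_scalel scaleNr.
rewrite (B_skew n m); move: (B m n) (B (a k) (m - n)) => Q P.
rewrite !scalerBr !scalerN !scalerA [D * 2%:R]mulrC.
move: (D *: Q) (_ *: P) => Q' P'.
rewrite opprB opprK -!addrA.
by rewrite addKr (addrCA Q') !addKr addNr addr0.
Qed.

End AlternatingForm.

Lemma rmorph_mutated_coef (K L : fieldType) (phi : {rmorphism K -> L})
    (T : finType) (k : T) (c : T -> T -> K) (x y : T -> K) (D : K) i j :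
  phi (mutated_coef k c x y D i j)
  = mutated_coef k (fun i j => phi (c i j)) (phi \o x) (phi \o y) (phi D) i j.
Proof.
by rewrite /mutated_coef /= !(rmorph_nat, rmorphB, rmorphD, rmorphM).
Qed.

(** * Partial derivatives of rational functions *)

Section Calculus.
Variables (F : fieldType) (I : finType).
Local Notation K := (ratfun F I).
Implicit Types (a : 'I_#|I|) (g h : K) (u v w : form1 F I).
Implicit Types (p q r s : {mpoly F[#|I|]}).

(** Typing the embedding of polynomials into fractions with codomain [ratfun],
    rather than with the fraction field to which it unfolds, keeps all ring
    operations on a single canonical structure. *)
Definition embed p : K := FracField.tofrac p.

Lemma embed_is_zmod_morphism : zmod_morphism embed.
Proof. exact: tofrac_is_zmod_morphism. Qed.

Lemma embed_is_monoid_morphism : monoid_morphism embed.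
Proof. exact: tofrac_is_monoid_morphism. Qed.

HB.instance Definition _ :=
  GRing.isZmodMorphism.Build {mpoly F[#|I|]} K embed embed_is_zmod_morphism.
HB.instance Definition _ :=
  GRing.isMonoidMorphism.Build {mpoly F[#|I|]} K embed embed_is_monoid_morphism.

Lemma embedM : {morph embed : p q / p * q}.
Proof. exact: rmorphM. Qed.

Lemma embed_eq0 p : (embed p == 0) = (p == 0).
Proof. exact: tofrac_eq0. Qed.

Lemma embed_inj : injective embed.
Proof. by move=> p q /eqP; rewrite tofrac_eq => /eqP. Qed.

Lemma ratfun_numden g : g = embed \n_(repr g) / embed \d_(repr g).
Proof. exact: frac_numden. Qed.

Lemma ratfunP g : exists p q, q != 0 /\ g = embed p / embed q.
Proof.
exists \n_(repr g), \d_(repr g).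
by split; [apply: denom_ratioP|apply: ratfun_numden].
Qed.

(** The representative that underlies [pderiv] and [pullback] is known only up
    to this relation. *)
Lemma repr_cross p q : q != 0 ->
  p * \d_(repr (embed p / embed q)) = \n_(repr (embed p / embed q)) * q.
Proof.
move=> q0; set g := embed p / embed q; have := ratfun_numden g.
set n := \n_(_); set d := \d_(_) => gE.
have pE : embed p = embed n / embed d * embed q.
  by rewrite -gE divfK ?embed_eq0.
by apply: embed_inj; rewrite !embedM pE mulrAC divfK // embed_eq0 denom_ratioP.
Qed.

Lemma pderivE a g : pderiv a g =
  embed (\n_(repr g)^`M(a) * \d_(repr g) - \n_(repr g) * \d_(repr g)^`M(a))
    / embed (\d_(repr g) ^+ 2).
Proof. by []. Qed.

Lemma AcoordE i : Acoord F i = embed 'X_(enum_rank i).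
Proof. by []. Qed.

(** The quotient rule gives the same value on every representative: if
    p d = n q, differentiating this relation shows that the two quotients
    agree. *)
Lemma pderiv_frac a p q : q != 0 ->
  pderiv a (embed p / embed q)
  = embed (p^`M(a) * q - p * q^`M(a)) / embed (q ^+ 2).
Proof.
move=> q0; rewrite pderivE; have := repr_cross p q0.
have : \d_(repr (embed p / embed q)) != 0 by apply: denom_ratioP.
set n := \n_(_); set d := \d_(_) => d0 E; clearbody n d.
have E' : p^`M(a) * d + p * d^`M(a) = n^`M(a) * q + n * q^`M(a).
  by rewrite -!mderivM E.
apply/eqP; rewrite eqr_div ?embed_eq0 ?expf_neq0 // -!rmorphM.
apply/eqP; congr embed.
have n'q : n^`M(a) * q = p^`M(a) * d + p * d^`M(a) - n * q^`M(a).
  by rewrite E' addrK.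
have -> : (n^`M(a) * d - n * d^`M(a)) * q ^+ 2
  = (n^`M(a) * q) * d * q - (n * q) * d^`M(a) * q by ring.
rewrite n'q -E.
have -> : (p^`M(a) * d + p * d^`M(a) - n * q^`M(a)) * d * q
   - p * d * d^`M(a) * q
 = (p^`M(a) * d + p * d^`M(a)) * d * q - (n * q) * q^`M(a) * d
   - p * d * d^`M(a) * q by ring.
by rewrite -E; ring.
Qed.

Lemma pderiv_embed a p : pderiv a (embed p) = embed p^`M(a).
Proof.
have := @pderiv_frac a p 1 (oner_neq0 _).
by rewrite rmorph1 divr1 mderivC mulr0 subr0 mulr1 expr1n rmorph1 divr1.
Qed.

Lemma pderivD a g h : pderiv a (g + h) = pderiv a g + pderiv a h.
Proof.
have [p [q [q0 ->]]] := ratfunP g; have [r [s [s0 ->]]] := ratfunP h.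
have Q0 : embed q != 0 by rewrite embed_eq0.
have S0 : embed s != 0 by rewrite embed_eq0.
rewrite (addf_div _ _ Q0 S0) -!rmorphM -rmorphD.
rewrite (pderiv_frac _ _ (mulf_neq0 q0 s0)).
rewrite (pderiv_frac _ _ q0) (pderiv_frac _ _ s0) mderivD !mderivM.
rewrite !(rmorphXn, rmorphB, rmorphD, rmorphM).
exact (@quotient_rule_add K (embed p) (embed q) (embed r) (embed s)
  (embed p^`M(a)) (embed q^`M(a)) (embed r^`M(a)) (embed s^`M(a)) Q0 S0).
Qed.

Lemma pderivM a g h : pderiv a (g * h) = pderiv a g * h + g * pderiv a h.
Proof.
have [p [q [q0 ->]]] := ratfunP g; have [r [s [s0 ->]]] := ratfunP h.
have Q0 : embed q != 0 by rewrite embed_eq0.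
have S0 : embed s != 0 by rewrite embed_eq0.
rewrite mulf_div -!rmorphM (pderiv_frac _ _ (mulf_neq0 q0 s0)).
rewrite (pderiv_frac _ _ q0) (pderiv_frac _ _ s0) !mderivM.
rewrite !(rmorphXn, rmorphB, rmorphD, rmorphM).
exact (@quotient_rule_mul K (embed p) (embed q) (embed r) (embed s)
  (embed p^`M(a)) (embed q^`M(a)) (embed r^`M(a)) (embed s^`M(a)) Q0 S0).
Qed.

Lemma differentialD g h : differential (g + h) = differential g + differential h.
Proof. by apply/rowP=> b; rewrite !mxE pderivD. Qed.

Lemma differentialM g h :
  differential (g * h) = h *: differential g + g *: differential h.
Proof. by apply/rowP=> b; rewrite !mxE pderivM mulrC. Qed.

Lemma dlogM g h : g != 0 -> h != 0 -> dlog (g * h) = dlog g + dlog h.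
Proof. exact: (logderM differentialM). Qed.

Lemma dlogV g : g != 0 -> dlog g^-1 = - dlog g.
Proof. exact: (logderV differentialM). Qed.

Lemma dlogXz g (z : int) : g != 0 -> dlog (g ^ z) = z%:~R *: dlog g.
Proof. exact: (logderXz differentialM). Qed.

Lemma dlog_prod (T : finType) (P : pred T) (G : T -> K) :
  (forall j, P j -> G j != 0) ->
  dlog (\prod_(j | P j) G j) = \sum_(j | P j) dlog (G j).
Proof. exact: (logder_prod differentialM). Qed.

Lemma dlogD g h : g != 0 -> h != 0 ->
  dlog (g + h) = (g + h)^-1 *: (g *: dlog g + h *: dlog h).
Proof. exact: (logderD differentialD). Qed.

Lemma wedgeDl u v w : wedge (u + v) w = wedge u w + wedge v w.
Proof. by rewrite /wedge linearD mulmxDl mulmxDr opprD addrACA. Qed.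

Lemma wedgeZl (c : K) u w : wedge (c *: u) w = c *: wedge u w.
Proof. by rewrite /wedge linearZ -scalemxAl -scalemxAr scalerBr. Qed.

Lemma wedgeC u v : wedge u v = - wedge v u.
Proof. by rewrite /wedge opprB. Qed.

Lemma wedgexx u : wedge u u = 0.
Proof. by rewrite /wedge subrr. Qed.

Lemma Acoord_neq0 (j : I) : Acoord F j != 0.
Proof.
rewrite AcoordE embed_eq0; apply/eqP => /(congr1 (mcoeff U_(enum_rank j)%MM)).
by rewrite mcoeffX mcoeff0 eqxx => /eqP; rewrite oner_eq0.
Qed.

Lemma pderiv_Acoord b (j : I) : pderiv b (Acoord F j) = (enum_rank j == b)%:R.
Proof.
rewrite AcoordE pderiv_embed mderivX mnm1E.
case: eqVneq => [->|_]; last by rewrite scale0r rmorph0.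
by rewrite scale1r -{1}[U_(b)%MM]add0m addmK mpolyX0 rmorph1.
Qed.

Lemma dlog_AcoordE b (j : I) :
  dlog (Acoord F j) 0 b = (Acoord F j)^-1 * (enum_rank j == b)%:R.
Proof. by rewrite !mxE pderiv_Acoord. Qed.

Lemma pchar_ratfun : [pchar F] =i pred0 -> [pchar K] =i pred0.
Proof.
move=> charF p; rewrite -charF.
exact: (fmorph_pchar (embed \o @mpolyC #|I| F)).
Qed.

(** A rational function that is a polynomial has a value at the point all of
    whose coordinates are 1; the exchange polynomials have value 2 there, which
    is the quickest way to see that they are not zero. *)
Definition value_at_ones (g : K) (c : F) :=
  exists2 p, g = embed p & p.@[fun=> 1] = c.

Lemma value_at_ones_neq0 g c : value_at_ones g c -> c != 0 -> g != 0.
Proof.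
move=> [p -> <-]; rewrite embed_eq0; apply: contraNneq => ->.
by rewrite meval0.
Qed.

Lemma value_at_ones_add g h c d :
  value_at_ones g c -> value_at_ones h d -> value_at_ones (g + h) (c + d).
Proof.
by move=> [p -> <-] [q -> <-]; exists (p + q); rewrite ?mevalD // rmorphD.
Qed.

Lemma value_at_ones_monomial (P : pred I) (z : I -> int) :
  (forall j, P j -> 0 <= z j) ->
  value_at_ones (\prod_(j | P j) Acoord F j ^ z j) 1.
Proof.
move=> z0; apply: (big_ind (fun g => value_at_ones g 1)).
- by exists 1; rewrite ?rmorph1 ?meval1.
- move=> _ _ [p -> p1] [q -> q1].
  by exists (p * q); rewrite ?embedM // mevalM p1 q1 mulr1.
move=> j /z0; case: (z j) => // n _.
exists ('X_(enum_rank j) ^+ n); first by rewrite rmorphXn.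
by rewrite rmorphXn /= mevalXU expr1n.
Qed.

Lemma dlog_monomial (P : pred I) (z : I -> int) :
  dlog (\prod_(j | P j) Acoord F j ^ z j)
  = \sum_j (if P j then (z j)%:~R else 0) *: dlog (Acoord F j).
Proof.
rewrite dlog_prod => [|j _]; last exact/expfz_neq0/Acoord_neq0.
rewrite big_mkcond; apply: eq_bigr => j _.
by case: ifP => _; rewrite ?scale0r // dlogXz ?Acoord_neq0.
Qed.

End Calculus.

(** * Substitution in polynomials, dominance and the Jacobian criterion *)

(** Induction over ring expressions, along which ring morphisms and derivations
    are compared. *)
Lemma mpoly_ring_ind (F : fieldType) (n : nat) (P : {mpoly F[n]} -> Prop) :
  (forall c, P c%:MP) -> (forall i, P 'X_i) ->
  (forall p q, P p -> P q -> P (p + q)) ->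
  (forall p q, P p -> P q -> P (p * q)) -> forall p, P p.
Proof.
move=> PC PX PD PM; elim/mpolyind => [|c m p _ _ Pp]; first by rewrite -mpolyC0.
apply: (PD) => //; rewrite -mul_mpolyC; apply: (PM) => //; rewrite mpolyXE_id.
apply: (big_ind P) => [|p1 p2|i _]; [by rewrite -mpolyC1|exact: PM|].
by elim: (m i) => [|k IHk]; rewrite ?expr0 ?exprS -?mpolyC1; auto.
Qed.

Section PolyPullback.
Variables (F : fieldType) (I J : finType) (f : ratmap F I J).

HB.instance Definition _ := GRing.RMorphism.copy (poly_pullback f)
  (mmap (@embed F I \o @mpolyC #|I| F) (fun a => f (enum_val a))).

Lemma poly_pullbackC c : poly_pullback f c%:MP = embed c%:MP.
Proof. exact: (@mmapC _ _ _ _ (@embed F I \o @mpolyC #|I| F)). Qed.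

Lemma poly_pullbackX a : poly_pullback f 'X_a = f (enum_val a).
Proof.
rewrite [LHS](@mmapX _ _ _ _ (@embed F I \o @mpolyC #|I| F)).
exact: mmap1U.
Qed.

End PolyPullback.

Lemma msize_mderiv_lt (F : fieldType) (n : nat) a (p : {mpoly F[n]}) :
  p^`M(a) != 0 -> (msize p^`M(a) < msize p)%N.
Proof.
move=> p'0; rewrite -(mlead_deg p'0).
set m := mlead _; have : m \in msupp p^`M(a) by rewrite mlead_supp.
rewrite mcoeff_msupp mcoeff_mderiv => pm.
have : (m + U_(a))%MM \in msupp p.
  by rewrite mcoeff_msupp; apply: contraNneq pm => ->; rewrite mul0rn.
by move/msize_mdeg_lt; rewrite mdegD mdeg1 addn1.
Qed.

Lemma mderiv_eq0 (F : fieldType) (n : nat) (p : {mpoly F[n]}) :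
  [pchar F] =i pred0 -> (forall a, p^`M(a) = 0) -> p = (p@_0%MM)%:MP.
Proof.
move=> charF p'0; apply/mpolyP=> m; rewrite mcoeffC.
have [->|m0] := eqVneq m 0%MM; first by rewrite mulr1.
rewrite mulr0.
have [a ma] : exists a, m a != 0%N.
  apply/existsP; apply: contraNT m0 => /existsPn m0.
  by apply/eqP/mnmP=> a; rewrite mnm0E; apply/eqP; rewrite -[_ == _]negbK.
have := mcoeff_mderiv a p (m - U_(a))%MM.
rewrite p'0 mcoeff0 submK ?lep1mP // => /esym/eqP.
by rewrite -mulr_natr mulf_eq0 (proj1 (pcharf0P F) charF) orbF => /eqP.
Qed.

(** Algebraic independence of the pullbacks of the coordinates. *)
Definition dominant (F : fieldType) (I J : finType) (f : ratmap F I J) :=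
  forall p, poly_pullback f p = 0 -> p = 0.

Section Substitution.
Variables (F : fieldType) (I J : finType) (f : ratmap F I J).

Lemma poly_chain_rule p :
  differential (poly_pullback f p)
  = (\row_a poly_pullback f p^`M(a)) *m jacobian f.
Proof.
elim/mpoly_ring_ind: p => [c|i|p q IHp IHq|p q IHp IHq].
- rewrite poly_pullbackC; apply/rowP=> b.
  rewrite !mxE pderiv_embed mderivC (rmorph0 (@embed F I)) big1 // => a _.
  by rewrite !mxE mderivC rmorph0 mul0r.
- rewrite poly_pullbackX; apply/rowP=> b.
  rewrite !mxE (bigD1 i) //= big1 ?addr0 => [|a ai].
    rewrite !mxE mderivX mnm1E eqxx scale1r -{1}[U_(i)%MM]add0m addmK.
    by rewrite mpolyX0 rmorph1 mul1r.
  by rewrite !mxE mderivX mnm1E eq_sym (negbTE ai) scale0r rmorph0 mul0r.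
- rewrite rmorphD differentialD IHp IHq -mulmxDl; congr (_ *m _).
  by apply/rowP=> a; rewrite !mxE mderivD rmorphD.
- rewrite rmorphM differentialM IHp IHq !scalemxAl -mulmxDl; congr (_ *m _).
  by apply/rowP=> a; rewrite !mxE mderivM rmorphD !rmorphM mulrC.
Qed.

(** A relation p(f) = 0 differentiates to a relation between the rows of the
    Jacobian with coefficients (dp/dX_a)(f); as the rows are independent, the
    partial derivatives of p are relations of smaller degree, hence zero, and p
    is constant. *)
Lemma dominant_jacobian : [pchar F] =i pred0 ->
  (forall v : 'rV_#|J|, v *m jacobian f = 0 -> v = 0) -> dominant f.
Proof.
move=> charF Jinj p; have [n] := ubnP (msize p).
elim: n p => // n IHn p /ltnSE lepn fp0.
have p'0 a : p^`M(a) = 0.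
  apply/eqP; apply: contraT => p'a; case/eqP: (p'a); apply: IHn.
    exact: leq_trans (msize_mderiv_lt p'a) lepn.
  have /Jinj/rowP/(_ a) : (\row_a poly_pullback f p^`M(a)) *m jacobian f = 0.
    rewrite -poly_chain_rule fp0; apply/rowP=> b.
    by rewrite !mxE -(rmorph0 (@embed F I)) pderiv_embed mderiv0.
  by rewrite !mxE.
move: fp0; rewrite (mderiv_eq0 charF p'0) poly_pullbackC => /eqP.
by rewrite embed_eq0 mpolyC_eq0 => /eqP ->; rewrite mpolyC0.
Qed.

Hypothesis domf : dominant f.

(** Dominance makes substitution independent of the representative. *)
Lemma pullback_frac p q : q != 0 ->
  pullback f (embed p / embed q)
  = poly_pullback f p / poly_pullback f q.
Proof.
have dom0 r : r != 0 -> poly_pullback f r != 0.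
  by apply: contraNneq => /domf ->.
move=> q0; rewrite /pullback; set g := embed p / _.
have d0 : \d_(repr g) != 0 by apply: denom_ratioP.
apply/eqP; rewrite eqr_div ?dom0 //.
by rewrite -!rmorphM repr_cross.
Qed.

Lemma pullback_embed p : pullback f (embed p) = poly_pullback f p.
Proof.
by have := pullback_frac p (oner_neq0 _); rewrite !rmorph1 !divr1.
Qed.

End Substitution.

(** * Functoriality of pullback along dominant maps *)

(** Pullback of forms is, in coordinates, a change of scalars by phi followed
    by multiplication with the Jacobian matrix; these are its formal properties
    over arbitrary fields. *)
Section MatrixPullback.
Variables (K L : fieldType) (phi : {rmorphism K -> L}) (m n : nat).
Variable Jac : 'M[L]_(m, n).

Lemma pull_row_lincomb (c d : K) (u v : 'rV_m) :
  map_mx phi (c *: u + d *: v) *m Jac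
  = phi c *: (map_mx phi u *m Jac) + phi d *: (map_mx phi v *m Jac).
Proof. by rewrite map_mxD !map_mxZ mulmxDl -!scalemxAl. Qed.

Lemma pull_row_scale (c : K) (u : 'rV_m) :
  map_mx phi (c *: u) *m Jac = phi c *: (map_mx phi u *m Jac).
Proof. by rewrite map_mxZ -scalemxAl. Qed.

Lemma pull_mx_wedge (u v : 'rV_m) :
  Jac^T *m map_mx phi (u^T *m v - v^T *m u) *m Jac
  = (map_mx phi u *m Jac)^T *m (map_mx phi v *m Jac)
    - (map_mx phi v *m Jac)^T *m (map_mx phi u *m Jac).
Proof.
by rewrite map_mxB !map_mxM -!matrix.map_trmx !trmx_mul mulmxBr mulmxBl !mulmxA.
Qed.

Lemma pull_mx_sum (T : finType) (P : pred T) (w : T -> 'M_m) :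
  Jac^T *m map_mx phi (\sum_(i | P i) w i) *m Jac
  = \sum_(i | P i) Jac^T *m map_mx phi (w i) *m Jac.
Proof. by rewrite map_mx_sum mulmx_sumr mulmx_suml. Qed.

Lemma pull_mx_ratr (r : rat) (w : 'M_m) :
  Jac^T *m map_mx phi (ratr r *: w) *m Jac
  = ratr r *: (Jac^T *m map_mx phi w *m Jac).
Proof. by rewrite map_mxZ fmorph_rat -scalemxAr -scalemxAl. Qed.

Lemma pull_mx_comp (p : nat) (H : 'M[K]_(p, m)) (w : 'M[K]_p) :
  (map_mx phi H *m Jac)^T *m map_mx phi w *m (map_mx phi H *m Jac)
  = Jac^T *m map_mx phi (H^T *m w *m H) *m Jac.
Proof. by rewrite !map_mxM -!matrix.map_trmx trmx_mul !mulmxA. Qed.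

End MatrixPullback.

Section DominantSubstitution.
Variables (F : fieldType) (I J : finType) (f : ratmap F I J).
Local Notation KI := (ratfun F I).
Local Notation KJ := (ratfun F J).
Hypothesis domf : dominant f.

Lemma pullbackB : zmod_morphism (pullback f).
Proof.
move=> g h.
have [p [q [q0 ->]]] := ratfunP g; have [r [s [s0 ->]]] := ratfunP h.
have Q0 : embed q != 0 by rewrite embed_eq0.
have S0 : embed s != 0 by rewrite embed_eq0.
rewrite -mulNr (addf_div _ _ Q0 S0) -rmorphN -!rmorphM -rmorphD.
rewrite (pullback_frac domf _ (mulf_neq0 q0 s0)) !(pullback_frac domf) //.
have dom0 t : t != 0 -> poly_pullback f t != 0.
  by apply: contraNneq => /domf ->.
rewrite -[in RHS]mulNr (addf_div _ _ (dom0 _ q0) (dom0 _ s0)).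
by rewrite rmorphD !rmorphM rmorphN.
Qed.

Lemma pullbackM : monoid_morphism (pullback f).
Proof.
split=> [|g h].
  by rewrite -(rmorph1 (@embed F J)) (pullback_embed domf) rmorph1.
have [p [q [q0 ->]]] := ratfunP g; have [r [s [s0 ->]]] := ratfunP h.
rewrite mulf_div -!rmorphM (pullback_frac domf _ (mulf_neq0 q0 s0)).
by rewrite !(pullback_frac domf) // mulf_div !rmorphM.
Qed.

HB.instance Definition _ :=
  GRing.isZmodMorphism.Build KJ KI (pullback f) pullbackB.
HB.instance Definition _ :=
  GRing.isMonoidMorphism.Build KJ KI (pullback f) pullbackM.

Lemma pullback_Acoord j : pullback f (Acoord F j) = f j.
Proof. by rewrite (pullback_embed domf) poly_pullbackX enum_rankK. Qed.

(** Writing p = g q with p and q polynomials and comparing the two Leibniz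
    expansions reduces the case of g to that of polynomials. *)
Lemma chain_rule g :
  differential (pullback f g)
  = map_mx (pullback f) (differential g) *m jacobian f.
Proof.
have [p [q [q0 gE]]] := ratfunP g.
have Q0 : embed q != 0 by rewrite embed_eq0.
have pE : embed p = g * embed q.
  by rewrite gE divfK.
have D r : differential (pullback f (embed r))
    = map_mx (pullback f) (differential (embed r)) *m jacobian f.
  rewrite (pullback_embed domf) poly_chain_rule; congr (_ *m _).
  by apply/rowP=> a; rewrite !mxE pderiv_embed (pullback_embed domf).
have Dp : pullback f (embed q) *: differential (pullback f g)
    + pullback f g *: differential (pullback f (embed q))
  = pullback f (embed q) *: (map_mx (pullback f) (differential g) *m jacobian f)
    + pullback f g
      *: (map_mx (pullback f) (differential (embed q)) *m jacobian f).
  have := D p; rewrite pE (rmorphM (pullback f)) !differentialM => ->.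
  exact: pull_row_lincomb.
move: Dp; rewrite -(D q) => /addIr/scalerI; apply.
by rewrite (pullback_embed domf); apply: contraNneq q0 => /domf ->.
Qed.

Lemma dlog_pullback g :
  dlog (pullback f g) = map_mx (pullback f) (dlog g) *m jacobian f.
Proof.
rewrite [RHS](pull_row_scale (pullback f)) -chain_rule.
by rewrite (fmorphV (pullback f)).
Qed.

Lemma pullback2_wedge_dlog g h :
  pullback2 f (wedge (dlog g) (dlog h))
  = wedge (dlog (pullback f g)) (dlog (pullback f h)).
Proof.
rewrite (dlog_pullback g) (dlog_pullback h).
exact: (pull_mx_wedge (pullback f)).
Qed.

Lemma pullback2_sum (T : finType) (P : pred T) (w : T -> form2 F J) :
  pullback2 f (\sum_(i | P i) w i) = \sum_(i | P i) pullback2 f (w i).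
Proof. exact: (pull_mx_sum (pullback f)). Qed.

Lemma pullback2_ratr (r : rat) (w : form2 F J) :
  pullback2 f (ratr r *: w) = ratr r *: pullback2 f w.
Proof. exact: (pull_mx_ratr (pullback f)). Qed.

Section Composition.
Variables (L : finType) (h : ratmap F J L).

Lemma poly_pullback_comp p :
  poly_pullback (ratmap_comp h f) p = pullback f (poly_pullback h p).
Proof.
elim/mpoly_ring_ind: p => [c|i|p q IHp IHq|p q IHp IHq].
- by rewrite !poly_pullbackC (pullback_embed domf) poly_pullbackC.
- by rewrite !poly_pullbackX.
- by rewrite !rmorphD /= IHp IHq.
- by rewrite !rmorphM /= IHp IHq.
Qed.

Hypothesis domh : dominant h.

Lemma dominant_comp : dominant (ratmap_comp h f).
Proof.
move=> p; rewrite poly_pullback_comp => /eqP.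
by rewrite (fmorph_eq0 (pullback f)) => /eqP/domh.
Qed.

Lemma pullback_comp g :
  pullback (ratmap_comp h f) g = pullback f (pullback h g).
Proof.
have [p [q [q0 ->]]] := ratfunP g.
rewrite (pullback_frac dominant_comp p q0) (pullback_frac domh p q0).
by rewrite (rmorphM (pullback f)) (fmorphV (pullback f)) !poly_pullback_comp.
Qed.

Lemma jacobian_comp :
  jacobian (ratmap_comp h f) = map_mx (pullback f) (jacobian h) *m jacobian f.
Proof.
have rowE (A B : finType) (k : ratmap F A B) i :
    row i (jacobian k) = differential (k (enum_val i)).
  by apply/rowP=> b; rewrite !mxE.
by apply/row_matrixP=> i; rewrite row_mul -map_row !rowE -chain_rule.
Qed.

Lemma pullback2_comp (w : form2 F L) :
  pullback2 (ratmap_comp h f) w = pullback2 f (pullback2 h w).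
Proof.
rewrite {1}/pullback2 jacobian_comp.
have -> : map_mx (pullback (ratmap_comp h f)) w
    = map_mx (pullback f) (map_mx (pullback h) w).
  by apply/matrixP=> i j; rewrite !mxE pullback_comp.
exact: (pull_mx_comp (pullback f)).
Qed.

End Composition.

End DominantSubstitution.

Lemma pullback2_Omega (F : fieldType) (I : finType) (t : seed)
    (f : ratmap F I (idx t)) : dominant f ->
  pullback2 f (Omega F t)
  = \sum_i \sum_j ratr ((sd i)%:R * eps i j) *: wedge (dlog (f i)) (dlog (f j)).
Proof.
move=> domf; rewrite [LHS](pullback2_sum domf); apply: eq_bigr => i _.
rewrite (pullback2_sum domf); apply: eq_bigr => j _.
rewrite (pullback2_ratr domf) (pullback2_wedge_dlog domf).
by rewrite !(pullback_Acoord domf).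
Qed.

(** * Seed isomorphisms and mutations *)

Lemma lincomb_rowE (R : fieldType) (n : nat) (c d e : R) (u v w : 'rV_n) b :
  (c *: (d *: u + e *: v) - w) 0 b = c * (d * u 0 b + e * v 0 b) - w 0 b.
Proof. by rewrite !mxE. Qed.

Section Invariance.
Variables (F : fieldType).
Hypothesis charF : [pchar F] =i pred0.
Local Notation A := (Acoord F).

Section Isomorphism.
Variables (s t : seed) (u : seed_iso s t).

(** The Jacobian is a permutation matrix. *)
Lemma dominant_iso : dominant (iso_map F u).
Proof.
apply: dominant_jacobian => // v /rowP vJ; apply/rowP=> a.
have := vJ (enum_rank (iso_inv u (enum_val a))).
rewrite !mxE (bigD1 a) //= !mxE pderiv_Acoord eqxx mulr1.
rewrite big1 ?addr0 // => b ba; rewrite !mxE pderiv_Acoord.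
rewrite (inj_eq enum_rank_inj) (can_eq (iso_invK u)) (inj_eq enum_val_inj).
by rewrite (negbTE ba) mulr0.
Qed.

Lemma Omega_iso : pullback2 (iso_map F u) (Omega F t) = Omega F s.
Proof.
rewrite (pullback2_Omega dominant_iso).
have bij_u : {on xpredT, bijective (iso_fun u)}.
  by exists (iso_inv u) => i _; [apply: iso_funK|apply: iso_invK].
rewrite (reindex _ bij_u); apply: eq_bigr => i _.
rewrite (reindex _ bij_u); apply: eq_bigr => j _.
by rewrite /iso_map !iso_funK iso_eps iso_sd.
Qed.

End Isomorphism.

Section Mutation.
Variables (s : seed) (k : idx s).
Hypothesis k_mutable : k \notin frozen s.
Local Notation K := (ratfun F (idx s)).

Definition eps_pos (j : idx s) : rat := if 0 < eps k j then eps k j else 0.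
Definition eps_neg (j : idx s) : rat := if eps k j < 0 then - eps k j else 0.

Lemma eps_diag (i : idx s) : eps i i = 0.
Proof.
have sd0 : (sd i)%:R != 0 :> rat by rewrite pnatr_eq0 -lt0n seed_gt0.
have := seed_skew i i; move/eqP; rewrite -addr_eq0 -mulr2n mulrn_eq0 /=.
by rewrite mulf_eq0 invr_eq0 (negbTE sd0) orbF => /eqP.
Qed.

Lemma eps_tilde_skew (i j : idx s) :
  (sd i)%:R * eps i j = - ((sd j)%:R * eps j i).
Proof.
have sd0 l : (sd l)%:R != 0 :> rat by rewrite pnatr_eq0 -lt0n seed_gt0.
have := seed_skew i j; rewrite -mulNr => /eqP; rewrite eqr_div // => /eqP E.
by rewrite mulrC E mulNr mulrC.
Qed.

Lemma eps_posBneg j : eps k j = eps_pos j - eps_neg j.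
Proof.
rewrite /eps_pos /eps_neg.
by case: ltrgt0P => [_|_|->]; rewrite ?opprK ?subr0 ?add0r.
Qed.

(** Skew-symmetry of d_i eps_ij turns the column eps_ik of the mutation rule
    into the row eps_ki: d_i |eps_ik| = d_k |eps_ki|, with opposite signs inside
    the absolute values. *)
Lemma mut_epsE (i j : idx s) :
  (sd i)%:R * mut_eps k i j
  = mutated_coef k (fun i j => (sd i)%:R * eps i j) eps_pos eps_neg
      (sd k)%:R i j.
Proof.
have posk : eps_pos k = 0 by rewrite /eps_pos eps_diag ltxx.
have negk : eps_neg k = 0 by rewrite /eps_neg eps_diag ltxx.
rewrite /mut_eps /mutated_coef (eq_sym k i) (eq_sym k j).
have [->|ik] := eqVneq i k => /=.
  by rewrite posk negk; case: eqVneq => [->|_]; rewrite ?eps_diag /=; ring.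
have [->|jk] := eqVneq j k => /=.
  by rewrite posk negk; ring.
rewrite !mul0r !subr0.
have di0 : 0 < (sd i)%:R :> rat by rewrite ltr0n seed_gt0.
have dk0 : 0 < (sd k)%:R :> rat by rewrite ltr0n seed_gt0.
have E : (sd i)%:R * `|eps i k| = (sd k)%:R * `|eps k i|.
  by rewrite -{1}(gtr0_norm di0) -normrM eps_tilde_skew normrN normrM gtr0_norm.
have -> : (eps i k * eps k j <= 0) = (0 <= eps k i * eps k j).
  rewrite -(pmulr_rle0 _ di0) mulrA eps_tilde_skew mulNr oppr_le0 -mulrA.
  by rewrite pmulr_rge0.
have -> : (sd i)%:R * (if 0 <= eps k i * eps k j then eps i j
            else eps i j + `|eps i k| * eps k j)
  = (sd i)%:R * eps i j
    + (sd k)%:R * (if 0 <= eps k i * eps k j then 0 else `|eps k i| * eps k j).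
  by case: ifP => _; rewrite ?mulr0 ?addr0 // mulrDr !mulrA E.
congr (_ + _ * _); rewrite /eps_pos /eps_neg.
case: (ltrgt0P (eps k i)) => [p0|p0|->]; last first.
- by rewrite mul0r lexx !mul0r subrr.
- rewrite nmulr_rge0 //.
  by case: (ltrgt0P (eps k j)) => [_|_|e0] /=; rewrite ?e0; ring.
- rewrite pmulr_rge0 //.
  by case: (ltrgt0P (eps k j)) => [_|_|e0] /=; rewrite ?e0; ring.
Qed.

Definition monomial_pos : K :=
  \prod_(j | 0 < eps k j) A j ^ Num.floor (eps k j).
Definition monomial_neg : K :=
  \prod_(j | eps k j < 0) A j ^ (- Num.floor (eps k j)).

Lemma floor_eps j : (Num.floor (eps k j))%:~R = eps k j.
Proof. by apply: floorK; rewrite seed_int // (negbTE k_mutable). Qed.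

Lemma monomial_pos1 : value_at_ones monomial_pos 1.
Proof.
by apply: value_at_ones_monomial => j /ltW; rewrite -(floor_ge0 (eps k j)).
Qed.

Lemma monomial_neg1 : value_at_ones monomial_neg 1.
Proof.
apply: value_at_ones_monomial => j ej.
by rewrite oppr_ge0 -(lerz0 rat) floor_eps ltW.
Qed.

Lemma exchange_neq0 : monomial_pos + monomial_neg != 0.
Proof.
apply: (value_at_ones_neq0 (value_at_ones_add monomial_pos1 monomial_neg1)).
by rewrite -mulr2n (proj1 (pcharf0P F) charF).
Qed.

Lemma dlog_monomial_pos :
  dlog monomial_pos = \sum_j ratr (eps_pos j) *: dlog (A j).
Proof.
rewrite [LHS]dlog_monomial; apply: eq_bigr => j _; congr (_ *: _).
rewrite /eps_pos; case: ifP => _; last by rewrite (ratr_int K 0).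
by rewrite -[in RHS]floor_eps ratr_int.
Qed.

Lemma dlog_monomial_neg :
  dlog monomial_neg = \sum_j ratr (eps_neg j) *: dlog (A j).
Proof.
rewrite [LHS]dlog_monomial; apply: eq_bigr => j _; congr (_ *: _).
rewrite /eps_neg; case: ifP => _; last by rewrite (ratr_int K 0).
by rewrite -[in RHS]floor_eps -intrN ratr_int.
Qed.

(** The mean of the logarithmic differentials of the two monomials, weighted by
    the monomials themselves: the vector theta of [mutation_identity]. *)
Definition dlog_exchange : form1 F (idx s) :=
  (monomial_pos + monomial_neg)^-1 *:
    (monomial_pos *: (\sum_j ratr (eps_pos j) *: dlog (A j))
     + monomial_neg *: (\sum_j ratr (eps_neg j) *: dlog (A j))).

Lemma dlog_mutation_map :
  dlog (mutation_map F k k) = dlog_exchange - dlog (A k).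
Proof.
rewrite /mutation_map eqxx -/monomial_pos -/monomial_neg.
have A0 := Acoord_neq0 F k.
have AV0 : (A k)^-1 != 0 by rewrite invr_eq0.
have pos0 := value_at_ones_neq0 monomial_pos1 (oner_neq0 F).
have neg0 := value_at_ones_neq0 monomial_neg1 (oner_neq0 F).
rewrite (dlogM exchange_neq0 AV0) (dlogV A0) (dlogD pos0 neg0).
by rewrite dlog_monomial_pos dlog_monomial_neg.
Qed.

(** As eps_kk = 0, the exchange binomial does not involve A_k, and only the
    factor 1 / A_k of the mutated coordinate depends on it. *)
Lemma dlog_mutation_map_k :
  dlog (mutation_map F k k) 0 (enum_rank k) = - (A k)^-1.
Proof.
have entry0 (x : idx s -> rat) : x k = 0 ->
    (\sum_j ratr (x j) *: dlog (A j)) 0 (enum_rank k) = 0.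
  move=> xk; rewrite summxE big1 // => j _; rewrite mxE dlog_AcoordE.
  have [->|jk] := eqVneq j k.
    by rewrite xk (ratr_int K 0) mul0r.
  by rewrite (inj_eq enum_rank_inj) (negbTE jk) !mulr0.
have pos0 : eps_pos k = 0 by rewrite /eps_pos eps_diag ltxx.
have neg0 : eps_neg k = 0 by rewrite /eps_neg eps_diag ltxx.
rewrite dlog_mutation_map [LHS]lincomb_rowE (entry0 _ pos0) (entry0 _ neg0).
by rewrite dlog_AcoordE eqxx mulr1 !mulr0 addr0 mulr0 add0r.
Qed.

Lemma mutation_map_ne i : i != k -> mutation_map F k i = A i.
Proof. by rewrite /mutation_map => /negbTE->. Qed.

(** The Jacobian is the identity outside row k, and its (k, k) entry is not
    zero. *)
Lemma dominant_mutation : dominant (mutation_map F k).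
Proof.
apply: dominant_jacobian => // v /rowP vJ.
have Jne a b : enum_val a != k ->
    jacobian (mutation_map F k) a b = (a == b)%:R.
  by move=> ak; rewrite mxE mutation_map_ne // pderiv_Acoord enum_valK.
have vk : v 0 (enum_rank k) = 0.
  have := vJ (enum_rank k); rewrite !mxE (bigD1 (enum_rank k)) //= big1.
    rewrite addr0 => /eqP; rewrite mulf_eq0 => /orP[/eqP//|].
    rewrite mxE enum_rankK => Jk0; move: dlog_mutation_map_k.
    rewrite !mxE (eqP Jk0) mulr0 => /eqP.
    by rewrite eq_sym oppr_eq0 invr_eq0 (negbTE (Acoord_neq0 _ _)).
  move=> a ak; rewrite Jne ?(negbTE ak) ?mulr0 //.
  by apply: contraNneq ak => <-; rewrite enum_valK.
apply/rowP=> b; rewrite [RHS]mxE.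
have [->//|bk] := eqVneq b (enum_rank k).
have := vJ b; rewrite !mxE (bigD1 b) //= big1 ?addr0.
  by rewrite Jne ?eqxx ?mulr1 //; apply: contraNneq bk => <-; rewrite enum_valK.
move=> a ab; have [->|ak] := eqVneq a (enum_rank k); first by rewrite vk mul0r.
rewrite Jne ?(negbTE ab) ?mulr0 //.
by apply: contraNneq ak => <-; rewrite enum_valK.
Qed.

Lemma Omega_mutation :
  pullback2 (mutation_map F k) (Omega F (mutate k_mutable)) = Omega F s.
Proof.
rewrite (@pullback2_Omega F (idx s) (mutate k_mutable) _ dominant_mutation).
pose phi := ratr_rmorphism (pchar_ratfun (idx s) charF).
pose c (i j : idx s) := phi ((sd i)%:R * eps i j).
pose x j := phi (eps_pos j); pose y j := phi (eps_neg j).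
have phi_coef i j : ratr ((sd i)%:R * mut_eps k i j)
    = mutated_coef k c x y (phi (sd k)%:R) i j.
  apply: (etrans (congr1 ratr (mut_epsE i j))).
  exact: (rmorph_mutated_coef phi).
have c_skew i j : c i j = - c j i by rewrite /c eps_tilde_skew rmorphN.
have c_k j : c k j = phi (sd k)%:R * (x j - y j).
  by rewrite /c /x /y -rmorphB -eps_posBneg rmorphM.
have x_k : x k = 0 by rewrite /x /eps_pos eps_diag ltxx rmorph0.
have y_k : y k = 0 by rewrite /y /eps_neg eps_diag ltxx rmorph0.
have E := @mutation_identity K _ _ (@wedge F (idx s))
  (@wedgeDl _ _) (@wedgeZl _ _) (@wedgeC _ _) (@wedgexx _ _)
  (idx s) (fun i => dlog (A i)) k c x y (phi (sd k)%:R)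
  monomial_pos monomial_neg c_skew c_k x_k y_k exchange_neq0
  (fun i => dlog (mutation_map F k i))
  (fun i ik => congr1 (@dlog F (idx s)) (mutation_map_ne ik))
  dlog_mutation_map.
rewrite -[RHS]E; apply: eq_bigr => i _; apply: eq_bigr => j _.
by rewrite -phi_coef.
Qed.

End Mutation.

(** Dominance is part of the induction because the pullback of a form along a
    composite is controlled only for dominant maps. *)
Lemma cluster_transformation_invariance (s t : seed)
    (f : ratmap F (idx s) (idx t)) :
  cluster_transformation f ->
  dominant f /\ pullback2 f (Omega F t) = Omega F s.
Proof.
elim=> {s t f} [s k hk|s t u|s t r f g _ [domf fO] _ [domg gO]].
- by split; [apply: dominant_mutation|apply: Omega_mutation].
- by split; [apply: dominant_iso|apply: Omega_iso].
- split; first exact: dominant_comp.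
  by rewrite (pullback2_comp domf domg) gO.
Qed.

End Invariance.

Theorem corollary6p5 (F : fieldType) (charF : [pchar F] =i pred0)
    (s t : seed) (f : ratmap F (idx s) (idx t)) :
  @cluster_transformation F s t f -> pullback2 f (Omega F t) = Omega F s.
Proof. by case/(cluster_transformation_invariance charF). Qed.
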